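(* Consider the Poisson multigraph model on the vertex set $[n]$: for each unordered pair $\{i,j\}$ of distinct vertices there are infinitely many parallel edges between $i$ and $j$, whose costs are the points of a Poisson process of intensity $1$ on $(0,\infty)$, these processes being independent for different pairs. Let $T_1$ be the minimum-cost spanning tree of this multigraph and, for $k\ge 2$, let $T_k$ be the minimum-cost spanning tree of the multigraph obtained by deleting the edges of $T_1,\dots,T_{k-1}$; let $w(T_k)$ be the total cost of the edges of $T_k$. Then for each $k\ge1$, $w(T_k)\to\gamma_k$ in probability as $n\to\infty$, where $\gamma_k$ is the same constant that is the limit in probability of the cost of the $k$-th greedily chosen edge-disjoint minimum spanning tree in the complete graph $K_n$ with i.i.d. uniform $(0,1)$ (or exponential mean $1$) edge costs.
   Context: In the simple-graph models: $K_n$ has i.i.d. edge costs, uniform on $(0,1)$ or exponential with mean 1; $T_1$ is the minimum spanning tree and $T_k$ is the minimum spanning tree of $K_n$ minus the edges of $T_1,\dots,T_{k-1}$ (with $w(T_k):=\infty$ if it does not exist); in those models $w(T_k)$ converges in probability to a constant $\gamma_k$ (the same for both distributions). *)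

(* Defs.v *)
From HB Require Import structures.
From mathcomp Require Import all_boot all_order all_algebra.
From mathcomp Require Import all_classical all_reals all_analysis.
Set Implicit Arguments.
Unset Strict Implicit.
Unset Printing Implicit Defensive.
Import Order.TTheory GRing.Theory Num.Theory.
Import numFieldNormedType.Exports.
Local Open Scope classical_set_scope.
Local Open Scope ring_scope.

(* Unordered pairs {i,j} of distinct vertices of [n] = 'I_n, stored as i < j. *)
Definition epair (n : nat) := {p : 'I_n * 'I_n | (p.1 < p.2)%N}.

Section Multigraph.
Context {R : realType} (n : nat) {E : eqType}
  (ends : E -> 'I_n * 'I_n) (c : E -> R).

Definition adj (F : seq E) : rel 'I_n :=
  fun x y => has (fun e => (ends e == (x, y)) || (ends e == (y, x))) F.

Definition connectedF (F : seq E) : Prop := forall x y, connect (adj F) x y.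

(* spanning tree: a (duplicate-free) set of edges that is connected and
   acyclic, acyclicity being expressed as: every edge is a bridge
   (removing it disconnects its endpoints). *)
Definition spanning_tree (F : seq E) : Prop :=
  [/\ uniq F, connectedF F &
      forall e, e \in F -> ~~ connect (adj (rem e F)) (ends e).1 (ends e).2].

Definition weight (F : seq E) : R := \sum_(e <- F) c e.

Definition is_MST (avail : pred E) (F : seq E) : Prop :=
  [/\ spanning_tree F, all avail F &
      forall F', spanning_tree F' -> all avail F' -> weight F <= weight F'].

Definition greedy_MSTs (Ts : seq (seq E)) : Prop :=
  forall i, (i < size Ts)%N ->
    is_MST (fun e => ~~ has (fun T => e \in T) (take i Ts)) (nth [::] Ts i).

(* "x is (a possible value of) w(T_k)": w(T_k) = +oo if T_k does not exist. *)
Definition kth_MST_weight (k : nat) (x : \bar R) : Prop :=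
  (exists Ts, [/\ size Ts = k, greedy_MSTs Ts & x = (weight (last [::] Ts))%:E])
  \/ (x = +oo%E /\ ~ exists Ts, size Ts = k /\ greedy_MSTs Ts).

End Multigraph.

Section Prob.
Context {d} {Omega : measurableType d} {R : realType} (P : probability Omega R).

Definition mutually_independent {I : eqType} (Y : I -> {RV P >-> R}) : Prop :=
  forall (J : seq I) (B : I -> set R), uniq J -> (forall i, measurable (B i)) ->
    P (\bigcap_(i in [set` J]) (Y i @^-1` B i)) =
    (\prod_(i <- J) P (Y i @^-1` B i))%E.

Definition iid_exp1 {I : eqType} (Y : I -> {RV P >-> R}) : Prop :=
  mutually_independent Y /\
  forall i (A : set R), measurable A ->
    P (Y i @^-1` A) = exponential_prob (1 : R) A.

(* convergence in probability to gamma of a sequence of (extended-real)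
   random quantities W n, given as relations "x is the value of W n at w" *)
Definition cvg_in_prob (W : nat -> Omega -> \bar R -> Prop) (gamma : R) : Prop :=
  forall eps : R, 0 < eps ->
    (fun n => P [set w | exists x, W n w x /\ ~ (`|x - gamma%:E| <= eps%:E)%E])
      @ \oo --> 0%E.

End Prob.

Definition simple_kth_weight {d} {Omega : measurableType d} {R : realType}
  {P : probability Omega R} (X : forall n, epair n -> {RV P >-> R}) (k : nat)
  : nat -> Omega -> \bar R -> Prop :=
  fun n w x => kth_MST_weight (fun e : epair n => val e) (fun e => X n e w) k x.

(* Poisson multigraph: the parallel edges between the pair p are indexed by
   m : nat; the m-th one (m = 0, 1, ...) has cost G p 0 + ... + G p m, the
   (m+1)-th point of a rate-1 Poisson process on (0,oo) whose inter-arrival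
   times are the i.i.d. Exp(1) variables G p 0, G p 1, ... *)
Definition poisson_kth_weight {d} {Omega : measurableType d} {R : realType}
  {P : probability Omega R} (G : forall n, epair n -> nat -> {RV P >-> R})
  (k : nat) : nat -> Omega -> \bar R -> Prop :=
  fun n w x => kth_MST_weight (fun e : epair n * nat => val e.1)
    (fun e => \sum_(m < e.2.+1) G n e.1 m w) k x.

Arguments mutually_independent {d Omega R} P {I} Y.
Arguments iid_exp1 {d Omega R} P {I} Y.
Arguments cvg_in_prob {d Omega R} P W gamma.

(* Main.v *)
(* Identify the simple model with the first arrivals [G p 0] of the Poisson
   multigraph. If the first arrivals with costs in (jM, (j+1)M] connect [n] for
   every j < k, then no tree T_1, ..., T_k uses a cost above t = kM. So only
   finitely many parallel edges matter; deleting one of them replaces, layer by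
   layer, a tree edge by the cheapest edge repairing the cut, and raises w(T_k)
   by an amount in [0, t]. Hence the two values of w(T_k) differ by at most t
   times the number of parallel edges of cost at most t, whose mean is O(n^2 t^2).
   With M = n^(-3/4) the connectivity fails with vanishing probability (union
   bound over cuts), while n^2 t^3 tends to 0. Ties are harmless: every choice of
   greedy trees in the multigraph yields some choice in the simple graph. *)
Require Import Defs.
From HB Require Import structures.
From mathcomp Require Import all_boot all_order all_algebra.
From mathcomp Require Import all_classical all_reals all_analysis.
From mathcomp Require Import measurable_realfun ring lra zify.
Set Implicit Arguments.
Unset Strict Implicit.
Unset Printing Implicit Defensive.
Import Order.TTheory GRing.Theory Num.Theory.
Import numFieldNormedType.Exports.
Local Open Scope ring_scope.

(** * Spanning trees and exchanges *)

Section Graph.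
Context {n : nat} {E : eqType} (ends : E -> 'I_n * 'I_n).
Local Notation conn F := (connect (adj ends F)).
Local Notation tree := (spanning_tree ends).
Implicit Types (F H T L : seq E) (e f g : E) (x y : 'I_n) (X : {set 'I_n}).

Definition crosses X e := ((ends e).1 \in X) != ((ends e).2 \in X).

Lemma adj_sym F : symmetric (adj ends F).
Proof. by move=> x y; apply: eq_has => e; rewrite orbC. Qed.

Lemma conn_sym F : connect_sym (adj ends F).
Proof. exact/sym_connect_sym/adj_sym. Qed.

Lemma adj_subset F H : {subset F <= H} -> subrel (adj ends F) (adj ends H).
Proof. by move=> FH x y /hasP[e /FH eH xy]; apply/hasP; exists e. Qed.

Lemma conn_subset F H : {subset F <= H} -> subrel (conn F) (conn H).
Proof.
move=> FH; apply: connect_sub => x y xy; exact/connect1/(adj_subset FH).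
Qed.

Lemma conn_ends F e : e \in F -> conn F (ends e).1 (ends e).2.
Proof.
by move=> eF; apply/connect1/hasP; exists e; rewrite // -surjective_pairing eqxx.
Qed.

Lemma crosses_setC X e : crosses (~: X) e = crosses X e.
Proof. by rewrite /crosses !inE; case: (_ \in X); case: (_ \in X). Qed.

Lemma conn_crosses F X x y : conn F x y -> x \in X -> y \notin X ->
  exists2 e, e \in F & crosses X e.
Proof.
case/connectP => p; elim: p x => [|z p IH] x /=; first by move=> _ -> ->.
case/andP => /hasP[e eF xz] zp yE xX yX.
have [zX|zX] := boolP (z \in X); first exact: IH zp yE zX yX.
exists e => //; rewrite /crosses.
by case/orP: xz => /eqP -> /=; rewrite xX (negbTE zX).
Qed.

(** A walk that uses [f] several times can be shortened to one that uses it at most once, in one of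
    its two directions. *)
Lemma conn_cons f F x y : conn (f :: F) x y ->
  [\/ conn F x y, conn F x (ends f).1 /\ conn F (ends f).2 y |
      conn F x (ends f).2 /\ conn F (ends f).1 y].
Proof.
case/connectP => p; elim: p x => [|z p IH] x /=.
  by move=> _ ->; apply: Or31; exact: connect0.
case/andP => xz zp yE; have {}IH := IH _ zp yE.
case/orP: xz => [|xz]; last first.
  have xz' : conn F x z by exact: connect1.
  case: IH => [zy|[z1 ?]|[z2 ?]].
  - apply: Or31; exact: connect_trans zy.
  - by apply: Or32; split=> //; exact: connect_trans z1.
  - by apply: Or33; split=> //; exact: connect_trans z2.
by case/orP => /eqP fE; move: IH; rewrite fE /= => -[zy|[z1 y2]|[z2 y1]];
  do ?[exact: Or31 | exact: Or32 | exact: Or33].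
Qed.

Lemma mem_cons_rem e F : e \in F -> e :: rem e F =i F.
Proof. by move=> eF x; exact/esym/(perm_mem (perm_to_rem eF)). Qed.

Lemma eq_conn F H : F =i H -> conn F =2 conn H.
Proof.
by move=> FH x y; apply/idP/idP; apply: conn_subset => z; rewrite FH.
Qed.

Lemma tree_split T e x : tree T -> e \in T ->
  conn (rem e T) x (ends e).1 \/ conn (rem e T) x (ends e).2.
Proof.
move=> [_ cT _] eT; have := cT x (ends e).1.
rewrite -(eq_conn (mem_cons_rem eT)) => /conn_cons[|[]|[]]; by [left|right].
Qed.

(** The edge [f] joins the two components of [T - e], so connectivity survives. Every other edge
    stays a bridge: a detour around it through [f] would already join the ends of [f] in [T - e]. *)
Lemma tree_swap T e f : tree T -> e \in T ->
  ~~ conn (rem e T) (ends f).1 (ends f).2 -> tree (f :: rem e T).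
Proof.
move=> treeT eT fN; have [uT cT bT] := treeT.
have fN' : f \notin rem e T by apply: contra fN; exact: conn_ends.
have sub1 g : {subset rem g (rem e T) <= rem e T} by exact: mem_subseq (rem_subseq _ _).
split.
- by rewrite /= fN' rem_uniq.
- suff ee : conn (f :: rem e T) (ends e).1 (ends e).2.
    move=> x y; have := cT x y.
    apply: connect_sub => {}x {}y xy.
    have: conn (e :: f :: rem e T) x y.
      apply: connect1; apply: adj_subset xy => g gT.
      rewrite !inE; have [//|ge] := eqVneq g e.
      by rewrite (rem_filter _ uT) mem_filter /= ge gT orbT.
    case/conn_cons => [//|[a b]|[a b]].
      exact: connect_trans a (connect_trans ee b).
    by apply: connect_trans a (connect_trans _ b); rewrite conn_sym.
  have sub : subrel (conn (rem e T)) (conn (f :: rem e T)).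
    by apply: conn_subset => g; rewrite inE orbC => ->.
  have ff : conn (f :: rem e T) (ends f).1 (ends f).2 by apply: conn_ends; exact: mem_head.
  have [f1|f1] := tree_split (ends f).1 treeT eT;
    have [f2|f2] := tree_split (ends f).2 treeT eT.
  + by case/negP: fN; apply: connect_trans f1 _; rewrite conn_sym.
  + apply: connect_trans (sub _ _ f2); apply: connect_trans ff.
    by apply: sub; rewrite conn_sym.
  + rewrite conn_sym; apply: connect_trans (sub _ _ f2); apply: connect_trans ff.
    by apply: sub; rewrite conn_sym.
  + by case/negP: fN; apply: connect_trans f1 _; rewrite conn_sym.
move=> g; rewrite inE /= => /predU1P[->|gT]; first by rewrite eqxx.
have gf : f != g by apply: contraNneq fN' => ->.
rewrite (negbTE gf) /=.
have gT' : g \in T by exact: mem_rem gT.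
have sub2 : subrel (conn (rem g (rem e T))) (conn (rem e T)) by exact: conn_subset.
have gg : conn (rem e T) (ends g).1 (ends g).2 by exact: conn_ends.
apply/negP => /conn_cons[g12|[a b]|[a b]].
- case/negP: (bT _ gT'); apply: conn_subset g12 => h.
  rewrite (rem_filter _ (rem_uniq _ uT)) !(rem_filter _ uT) !mem_filter /=.
  by case/and3P => -> _ ->.
- case/negP: fN; apply: (@connect_trans _ _ (ends g).1).
    by rewrite conn_sym; exact: sub2.
  by apply: connect_trans gg _; rewrite conn_sym; exact: sub2.
- case/negP: fN; apply: (@connect_trans _ _ (ends g).2); first exact: sub2.
  by rewrite conn_sym; apply: connect_trans gg; rewrite conn_sym; exact: sub2.
Qed.

(** Edges are dropped as long as [x] and [y] stay joined; the resulting set plays the role of a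
    simple path. *)
Lemma minimal_conn F x y : uniq F -> conn F x y -> exists D,
  [/\ uniq D, {subset D <= F}, conn D x y &
      forall g, g \in D -> ~~ conn (rem g D) x y].
Proof.
have [m] := ubnP (size F); elim: m F => // m IH F; rewrite ltnS => Fm uF Fxy.
have [/hasP[g gF gxy]|/hasPn noF] := boolP (has (fun g => conn (rem g F) x y) F).
  have [||D [uD DF Dxy Dmin]] := IH _ _ _ gxy.
  - by apply: leq_trans Fm; rewrite size_rem // ltn_predL; case: (F) gF.
  - exact: rem_uniq.
  by exists D; split=> // z /DF /mem_rem.
by exists F; split.
Qed.

(* On a minimal set of tree edges joining the ends of [e], every edge
   separates these ends in the whole tree, by the bridge property; one of them
   crosses [X]. *)
Lemma tree_exchange F e X : tree F -> crosses X e ->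
  exists g, [/\ g \in F, crosses X g & tree (e :: rem g F)].
Proof.
move=> treeF; wlog e1X : X / (ends e).1 \in X.
  move=> wl; have [/wl //|e1X] := boolP ((ends e).1 \in X).
  rewrite -crosses_setC => /wl; rewrite inE e1X => -[//|g [gF gX ?]].
  by exists g; split=> //; rewrite -crosses_setC.
rewrite {1}/crosses e1X => eX.
have {eX}e2X : (ends e).2 \notin X by case: (_ \in X) eX.
have [uF cF bF] := treeF.
have [D [uD DF Dxy Dmin]] := minimal_conn uF (cF (ends e).1 (ends e).2).
have [g gD gX] := conn_crosses Dxy e1X e2X.
have gF := DF _ gD.
exists g; split=> //; apply: tree_swap => //; apply/negP => exy.
have sub : subrel (conn (rem g D)) (conn (rem g F)).
  apply: conn_subset => h; rewrite !rem_filter // !mem_filter => /andP[->].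
  exact: DF.
case/negP: (bF _ gF); have := Dxy.
rewrite -(eq_conn (mem_cons_rem gD)) => /conn_cons[xy|[a b]|[a b]].
- by case/negP: (Dmin _ gD).
- apply: (@connect_trans _ _ (ends e).1); first by rewrite conn_sym; exact: sub.
  by apply: connect_trans exy _; rewrite conn_sym; exact: sub.
- apply: (@connect_trans _ _ (ends e).2); first exact: sub.
  by rewrite conn_sym; apply: connect_trans exy; rewrite conn_sym; exact: sub.
Qed.

(** Edges that are not bridges are removed one at a time, which never breaks connectivity. *)
Lemma tree_subseq F : uniq F -> connectedF ends F ->
  exists2 T : seq E, {subset T <= F} & tree T.
Proof.
have [m] := ubnP (size F); elim: m F => // m IH F; rewrite ltnS => Fm uF cF.
have [/hasP[g gF gxy]|/hasPn noF] :=
  boolP (has (fun g => conn (rem g F) (ends g).1 (ends g).2) F).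
  have [|||T TF treeT] := IH (rem g F).
  - by apply: leq_trans Fm; rewrite size_rem // ltn_predL; case: (F) gF.
  - exact: rem_uniq.
  - move=> x y; have := cF x y.
    rewrite -(eq_conn (mem_cons_rem gF)) => /conn_cons[//|[a b]|[a b]].
      exact: connect_trans a (connect_trans gxy b).
    by apply: connect_trans a (connect_trans _ b); rewrite conn_sym.
  by exists T => // z /TF /mem_rem.
by exists F.
Qed.

(** Otherwise the component of [x] would be a cut that no edge of [F] crosses. *)
Lemma cuts_connected F :
  (forall X x y, x \in X -> y \notin X -> exists2 e, e \in F & crosses X e) ->
  connectedF ends F.
Proof.
move=> cuts x y; apply: contraT => nxy.
have [||e eF] := cuts [set z | conn F x z]%SET x y; rewrite ?inE ?connect0 //.
rewrite /crosses !inE => /negP[]; apply/eqP.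
apply: (same_connect_r (conn_sym F)); exact: conn_ends.
Qed.

Lemma crossesP X e : crosses X e -> exists x y, x \in X /\ y \notin X.
Proof.
rewrite /crosses; have [a|a] := boolP ((ends e).1 \in X);
  have [b|b] := boolP ((ends e).2 \in X) => // _.
  by exists (ends e).1, (ends e).2.
by exists (ends e).2, (ends e).1.
Qed.

(** [X] is the fundamental cut of [e]: the component of one end of [e] in [T - e]. Any edge across
    it can stand in for [e]. *)
Lemma tree_cut T e : tree T -> e \in T -> exists X,
  crosses X e /\ forall f, crosses X f -> tree (f :: rem e T).
Proof.
move=> treeT eT; have [uT cT bT] := treeT.
exists [set z | conn (rem e T) (ends e).1 z]%SET; split.
  by rewrite /crosses !inE connect0 (negbTE (bT _ eT)).
move=> f; rewrite /crosses !inE => fX; apply: tree_swap => //.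
apply: contraNN fX => f12; apply/eqP.
exact: (same_connect_r (conn_sym _)).
Qed.

Lemma tree_perm F H : perm_eq F H -> tree F -> tree H.
Proof.
move=> FH [uF cF bF]; split.
- by rewrite -(perm_uniq FH).
- by move=> x y; rewrite -(eq_conn (perm_mem FH)).
move=> e; rewrite -(perm_mem FH) => eF.
suff E' : rem e F =i rem e H by rewrite -(eq_conn E'); exact: bF.
by move=> z; rewrite !rem_filter -?(perm_uniq FH)// !mem_filter (perm_mem FH).
Qed.

End Graph.

(** * Minimum spanning trees *)

Lemma seq_argmin (R : realType) (E : eqType) (c : E -> R) (P : pred E) (L : seq E) :
  has P L ->
  exists f, [/\ f \in L, P f & forall g, g \in L -> P g -> c f <= c g].
Proof.
elim: L => //= a L IH.
have [/IH[f [fL Pf fmin]] _|noL] := boolP (has P L); last first.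
  rewrite orbF => Pa; exists a; split; rewrite ?mem_head// => g.
  rewrite inE => /predU1P[->//|gL] Pg; case/negP: noL.
  by apply/hasP; exists g.
have [Pa|Pa] := boolP (P a); last first.
  exists f; split; rewrite ?inE ?fL ?orbT// => g.
  by rewrite inE => /predU1P[->|/fmin//]; rewrite (negbTE Pa).
have [ca|cf] := leP (c a) (c f).
  exists a; split; rewrite ?mem_head// => g.
  rewrite inE => /predU1P[->//|gL] Pg; apply: le_trans ca _; exact: fmin.
exists f; split; rewrite ?inE ?fL ?orbT// => g.
by rewrite inE => /predU1P[-> _|/fmin//]; exact: ltW.
Qed.

Section MST.
Context {R : realType} {n : nat} {E : eqType} (ends : E -> 'I_n * 'I_n) (c : E -> R).
Local Notation tree := (spanning_tree ends).
Local Notation mst := (is_MST ends c).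
Local Notation w := (weight c).
Implicit Types (A B : pred E) (F T L : seq E) (e f g : E) (X : {set 'I_n}).

Lemma weight_swap T e f : e \in T -> w (f :: rem e T) = w T + (c f - c e).
Proof.
move=> eT; rewrite /weight big_cons (perm_big _ (perm_to_rem eT)) big_cons.
by rewrite [c f - _]addrC addrACA subrr add0r addrC.
Qed.

Lemma is_MST_restrict A B T : mst A T -> all B T -> subpred B A -> mst B T.
Proof.
move=> [tT _ Tmin] BT BA; split=> // F tF /(sub_all BA); exact: Tmin.
Qed.

Lemma eq_is_MST A B T : A =1 B -> mst A T -> mst B T.
Proof.
move=> AB mT; apply: (is_MST_restrict mT) => [|e]; last by rewrite AB.
by case: mT => _ + _; rewrite (eq_all AB).
Qed.

(** Connectivity by edges of cost at most [b], phrased through cuts because [A] may be infinite and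
    because a cut directly supplies an exchange edge. *)
Definition cuts_below A (b : R) := forall X x y, x \in X -> y \notin X ->
  exists f, [/\ A f, crosses ends X f & c f <= b].

Lemma all_rem A e T : all A T -> all A (rem e T).
Proof. by move=> /allP AT; apply/allP => x /mem_rem; exact: AT. Qed.

(** Swapping [e] for an edge of cost at most [b] across its fundamental cut cannot lower the weight
    of a minimum tree. *)
Lemma MST_cost_le A b T : mst A T -> cuts_below A b ->
  forall e, e \in T -> c e <= b.
Proof.
move=> [tT AT Tmin] cuts e eT.
have [X [eX Xtree]] := tree_cut tT eT.
have [x [y [xX yX]]] := crossesP eX.
have [f [Af fX fb]] := cuts _ _ _ xX yX.
apply: le_trans fb; have := Tmin _ (Xtree f fX).
by rewrite /= Af all_rem// weight_swap// => /(_ isT); rewrite lerDl subr_ge0.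
Qed.

(** [A] may be infinite, but edges outside the finite list [L] can be exchanged for edges inside it
    without raising the weight, and up to order only finitely many trees lie in [L]. *)
Lemma MST_exists A b L : (forall e, A e -> c e <= b -> e \in L) ->
  cuts_below A b -> exists T, mst A T.
Proof.
move=> AL cuts.
(* Induction on the number of edges outside [L]: such an edge costs more than [b], its substitute at
   most [b]. *)
have lift F : tree F -> all A F -> exists F',
    [/\ tree F', all A F', {subset F' <= L} & w F' <= w F].
  have [m] := ubnP (count (fun e => e \notin L) F).
  elim: m F => // m IH F; rewrite ltnS => Fm tF AF.
  have [/hasP[e eF eL]|/hasPn noF] := boolP (has (fun e => e \notin L) F); last first.
    by exists F; split=> // e /noF; rewrite negbK.
  have Ae := allP AF _ eF.
  have [X [eX Xtree]] := tree_cut tF eF.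
  have [x [y [xX yX]]] := crossesP eX.
  have [f [Af fX fb]] := cuts _ _ _ xX yX.
  have [|||F' [tF' AF' F'L wF']] := IH (f :: rem e F).
  - rewrite /= (AL _ Af fb) add0n count_rem eF eL /=.
    apply: leq_trans Fm; rewrite subn1 ltn_predL -has_count.
    by apply/hasP; exists e.
  - exact: Xtree.
  - by rewrite /= Af all_rem.
  exists F'; split=> //; apply: le_trans wF' _.
  rewrite weight_swap// gerDl subr_le0; apply: le_trans fb _.
  by case: (leP (c e) b) => [/(AL _ Ae)|/ltW//]; rewrite (negbTE eL).
set U := undup L.
have [|F0 F0U tF0] := @tree_subseq _ _ ends [seq e <- U | A e] (filter_uniq _ (undup_uniq _)).
  apply: cuts_connected => X x y xX yX; have [f [Af fX fb]] := cuts _ _ _ xX yX.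
  by exists f => //; rewrite mem_filter Af mem_undup AL.
(* Trees inside [L] are encoded by bit masks on [U], which makes the search space a finite type. *)
have sub F : tree F -> {subset F <= L} ->
    exists m : (size U).-tuple bool, perm_eq F (mask m U).
  move=> [uF _ _] FL; have sz : size (map (mem F) U) == size U by rewrite size_map.
  exists (Tuple sz); rewrite /= -filter_mask; apply: uniq_perm => //.
    by rewrite filter_uniq ?undup_uniq.
  move=> e; rewrite mem_filter mem_undup /=.
  by apply/idP/andP => [eF|[]//]; rewrite eF FL.
pose P (m : (size U).-tuple bool) := `[< tree (mask m U) >] && all A (mask m U).
have [|m [_ /andP[/asboolP tm Am] mmin]] :=
    @seq_argmin R _ (fun m : (size U).-tuple bool => w (mask m U)) P (enum predT).
  have [|m Fm] := sub F0 tF0; first by move=> e /F0U; rewrite mem_filter mem_undup => /andP[].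
  apply/hasP; exists m; rewrite ?mem_enum// /P; apply/andP; split.
    by apply/asboolP; exact: tree_perm tF0.
  by rewrite -(perm_all _ Fm); apply/allP => e /F0U; rewrite mem_filter => /andP[].
exists (mask m U); split=> // F tF AF.
have [F' [tF' AF' F'L wF']] := lift F tF AF; apply: le_trans wF'.
have [m' Fm'] := sub _ tF' F'L.
rewrite /w (perm_big _ Fm'); apply: mmin; rewrite ?mem_enum// /P -(perm_all _ Fm') AF' andbT.
by apply/asboolP; exact: tree_perm tF'.
Qed.

(** If [e] is in [T], the cheapest available edge [f] across its fundamental cut replaces it;
    otherwise [T] stays and [f] is [e]. The equation on available edges says that in the next layer
    the deletion of [e] has turned into the deletion of [f]. *)
Lemma MST_delete A b L T e : (forall f, A f -> c f <= b -> f \in L) ->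
  (forall f, 0 <= c f) -> 0 <= b -> mst A T -> cuts_below [pred f | A f & f != e] b ->
  exists T' f, [/\ mst [pred f | A f & f != e] T',
    (forall g, A g && (g \notin T) && (g != f) = A g && (g != e) && (g \notin T')),
    w T <= w T', w T' <= w T + b & f = e \/ c f <= b].
Proof.
move=> AL c0 b0 mT cuts; have [tT AT Tmin] := mT.
have [eT|eT] := boolP (e \in T); last first.
  exists T, e; split=> //; last by left.
  - apply: is_MST_restrict mT _ _ => [|f /andP[]//].
    apply/allP => f fT /=; rewrite (allP AT)//=; by apply: contraNneq eT => <-.
  - by move=> g; rewrite andbAC.
  - by rewrite lerDl.
have [X [eX Xtree]] := tree_cut tT eT.
have [x [y [xX yX]]] := crossesP eX.
have [f0 [/andP[Af0 f0e] f0X f0b]] := cuts _ _ _ xX yX.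
pose P := [pred f | [&& A f, f != e & crosses ends X f]].
have [|f [fL /and3P[Af fe fX] fmin]] := @seq_argmin R _ c P L.
  by apply/hasP; exists f0; [exact: AL | apply/and3P].
have Pf0 : P f0 by apply/and3P.
have fb : c f <= b by apply: (le_trans _ f0b); apply: fmin => //; exact: AL.
(* The minimum over [L] is a minimum over all candidates, since an edge costing more than [b] also
   costs more than [f]. *)
have {}fmin g : P g -> c f <= c g.
  move=> /[dup] Pg /and3P[Ag _ _]; have [gb|/ltW] := leP (c g) b.
    by apply: fmin => //; exact: AL.
  exact: le_trans.
have tT' := Xtree _ fX; have [uT' _ _] := tT'.
have [uT _ _] := tT.
exists (f :: rem e T), f; split=> //; last by right.
- split=> //.
    rewrite /= Af fe; apply/allP => g; rewrite rem_filter// mem_filter => /andP[ge gT] /=.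
    by rewrite (allP AT).
  (* A competitor [F] has an edge [g] across the same cut. Exchanging [g] for [e] gives a tree no
     lighter than [T], and [c f <= c g]. *)
  move=> F tF AF; have [g [gF gX tF']] := tree_exchange tF eX.
  have /andP[Ag ge] := allP AF _ gF.
  have := Tmin _ tF'; rewrite /= (allP AT _ eT) all_rem; last first.
    by apply/allP => h /(allP AF)/andP[].
  move=> /(_ isT); rewrite !weight_swap// => wT.
  have : c f <= c g by apply: fmin; apply/and3P.
  move: wT; clear; move: (w F) (w T) => wF wT; lra.
- move=> g; rewrite inE rem_filter// mem_filter /= !negb_or negb_and negbK.
  have [->|ge] := eqVneq g e; first by rewrite eT andbF.
  by rewrite /= !andbT -!andbA; congr (_ && _); rewrite andbC.
- rewrite weight_swap// lerDl subr_ge0.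
  have := Tmin _ tT'; rewrite /= Af all_rem// => /(_ isT).
  by rewrite weight_swap// lerDl subr_ge0.
- by rewrite weight_swap// lerD2l lerBlDr -[leLHS]addr0 lerD.
Qed.

End MST.

(** * Greedy sequences of trees *)

Section Greedy.
Context {R : realType} {n : nat} {E : eqType} (ends : E -> 'I_n * 'I_n) (c : E -> R).
Local Notation mst := (is_MST ends c).
Local Notation w := (weight c).
Implicit Types (A B : pred E) (F T L D : seq E) (Ts : seq (seq E)) (e f g : E).

(** Recursive form of [greedy_MSTs] with the available edges as a parameter, for induction layer by
    layer. *)
Fixpoint greedy_in A Ts : Prop :=
  if Ts is T :: Ts' then
    mst A T /\ greedy_in [pred e | A e & e \notin T] Ts'
  else True.

Lemma eq_greedy_in A B Ts : A =1 B -> greedy_in A Ts -> greedy_in B Ts.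
Proof.
elim: Ts A B => //= T Ts IH A B AB [mT gTs]; split; first exact: eq_is_MST mT.
by apply: IH gTs => e /=; rewrite AB.
Qed.

Lemma greedy_inP Ts : greedy_MSTs ends c Ts <-> greedy_in predT Ts.
Proof.
suff gen A : greedy_in A Ts <-> forall i, (i < size Ts)%N ->
    mst (fun e => A e && ~~ has (fun T => e \in T) (take i Ts)) (nth [::] Ts i).
  by rewrite gen.
elim: Ts A => //= T Ts IH A; split.
  move=> [mT /IH gTs] [_|i /gTs]; first by apply: eq_is_MST mT => e; rewrite andbT.
  by apply: eq_is_MST => e /=; rewrite negb_or andbA.
move=> gTs; split; first by apply: eq_is_MST (gTs 0%N isT) => e; rewrite andbT.
apply/IH => i iTs; apply: eq_is_MST (gTs i.+1 iTs) => e /=.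
by rewrite negb_or andbA.
Qed.

Lemma greedy_in_restrict A B Ts : greedy_in A Ts -> subpred B A ->
  (forall T e, T \in Ts -> e \in T -> A e -> B e) -> greedy_in B Ts.
Proof.
elim: Ts A B => //= T Ts IH A B [mT gTs] BA BTs; have [_ AT _] := mT; split.
  apply: is_MST_restrict mT _ BA; apply/allP => e eT.
  by apply: (BTs T) => //; [exact: mem_head | exact: (allP AT)].
apply: IH gTs _ _ => [e /= /andP[/BA->]//|T' e T'Ts eT' /= /andP[Ae ->]].
by rewrite (BTs T')// inE T'Ts orbT.
Qed.

(* The available edges with costs in each of [k] consecutive intervals of length
   [M], starting at [b], connect all vertices. Hence the [j]-th greedy tree only
   uses costs up to [b + M *+ j] and leaves the later intervals intact. *)
Definition windows A (b M : R) (k : nat) := forall j X x y,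
  (j < k)%N -> x \in (X : {set 'I_n}) -> y \notin X ->
  exists f, [/\ A f, crosses ends X f, b + M *+ j < c f & c f <= b + M *+ j.+1].

Lemma windows_cuts A b M k : windows A b M k.+1 -> cuts_below ends c A (b + M).
Proof.
move=> win X x y xX yX; have [f [Af fX _ fb]] := win 0%N X x y isT xX yX.
by exists f; split.
Qed.

Lemma windows_sub A B b M k : subpred A B -> windows A b M k -> windows B b M k.
Proof.
move=> AB win j X x y jk xX yX; have [f [Af ? ? ?]] := win j X x y jk xX yX.
by exists f; split=> //; exact: AB.
Qed.

Lemma windows_shift A B b M k : 0 <= M ->
  (forall e, A e -> b + M < c e -> B e) ->
  windows A b M k.+1 -> windows B (b + M) M k.
Proof.
move=> M0 AB win j X x y jk xX yX.
have [f [Af fX bf fb]] := win j.+1 X x y jk xX yX.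
exists f; rewrite -!addrA -!mulrS; split=> //; apply: AB Af _.
by apply: le_lt_trans bf; rewrite lerD2l mulrS lerDl mulrn_wge0.
Qed.

Lemma windows_MST A b M k T : 0 <= M -> mst A T -> windows A b M k.+1 ->
  windows [pred e | A e & e \notin T] (b + M) M k.
Proof.
move=> M0 mT win; apply: windows_shift (win) => // e Ae be /=; rewrite Ae /=.
by apply: contraL be => /(MST_cost_le mT (windows_cuts win)); rewrite leNgt.
Qed.

Lemma greedy_cost_le A b M Ts T e : 0 <= M -> greedy_in A Ts ->
  windows A b M (size Ts) -> T \in Ts -> e \in T -> c e <= b + M *+ size Ts.
Proof.
move=> M0; elim: Ts A b => //= T' Ts IH A b [mT gTs] win.
rewrite inE => /predU1P[->|TTs] eT.
  apply: le_trans (MST_cost_le mT (windows_cuts win) eT) _.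
  by rewrite mulrS addrA lerDl mulrn_wge0.
by rewrite mulrS addrA; apply: IH gTs _ TTs eT; exact: windows_MST win.
Qed.

Lemma greedy_exists A b M k L : 0 <= M ->
  (forall e, A e -> c e <= b + M *+ k -> e \in L) -> windows A b M k ->
  exists2 Ts, size Ts = k & greedy_in A Ts.
Proof.
move=> M0; elim: k A b => [|k IH] A b AL win; first by exists [::].
have [|T mT] := MST_exists (L := L) _ (windows_cuts win).
  by move=> e Ae eb; apply: AL => //; apply: le_trans eb _;
    rewrite mulrS addrA lerDl mulrn_wge0.
have [|Ts <- gTs] := IH [pred e | A e & e \notin T] (b + M) _ (windows_MST M0 mT win).
  by move=> e /andP[Ae _]; rewrite -addrA -mulrS; exact: AL.
by exists (T :: Ts).
Qed.

(* In each layer, deleting [e] from the tree [T] brings in the cheapest edge [f]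
   reconnecting [T - e], which amounts to deleting [f] from the next layer. *)
Lemma greedy_delete A b M t Ts e L : (forall f, 0 <= c f) -> 0 <= b -> 0 <= M ->
  b + M *+ size Ts <= t -> (forall f, A f -> c f <= t -> f \in L) ->
  greedy_in A Ts -> windows [pred f | A f & f != e] b M (size Ts) ->
  exists Ts', [/\ size Ts' = size Ts, greedy_in [pred f | A f & f != e] Ts',
    w (last [::] Ts) <= w (last [::] Ts') & w (last [::] Ts') <= w (last [::] Ts) + t].
Proof.
move=> c0 b0 M0; elim: Ts A b e b0 => [|T Ts IH] A b e b0 bt AL /= gTs win.
  exists [::]; split=> //; rewrite lerDl; apply: le_trans bt.
  by rewrite addr_ge0// mulrn_wge0.
have {gTs} [mT gTs] := gTs.
have bM0 : 0 <= b + M by rewrite addr_ge0.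
have bMt : b + M <= t.
  by apply: le_trans bt; rewrite /= mulrS addrA lerDl mulrn_wge0.
have AL' f : A f -> c f <= b + M -> f \in L.
  by move=> Af fb; apply: AL => //; exact: le_trans bMt.
have cuts := windows_cuts win.
have [T' [f [mT' TT' wTT' wT'T fP]]] := MST_delete AL' c0 bM0 mT cuts.
have cutsA : cuts_below ends c A (b + M).
  move=> X x y xX yX; have [g [/andP[? _] ? ?]] := cuts X x y xX yX.
  by exists g.
have cT := MST_cost_le mT cutsA.
have [|||Ts' [sTs' gTs' wl wu]] := IH [pred g | A g & g \notin T] (b + M) f bM0 _ _ gTs.
- by apply: le_trans bt; rewrite /= mulrS addrA.
- by move=> g /andP[Ag _]; exact: AL.
(* Neither [T] nor [f] touches the later windows: the edges of [T] cost at most [b + M], and so does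
   [f] unless it is [e], which the windows already avoid. *)
- apply: windows_shift (win) => // g /= /andP[Ag ge] bg; rewrite Ag /=.
  apply/andP; split; first by apply: contraL bg => /cT; rewrite leNgt.
  case: fP => [->//|fb]; apply: contraL bg => /eqP ->.
  by rewrite -leNgt.
exists (T' :: Ts'); split.
- by rewrite /= sTs'.
- by split=> //=; apply: eq_greedy_in gTs' => g /=; exact: TT'.
- by case: Ts Ts' sTs' wl {IH bt gTs gTs' win wu} => [|? ?] [].
- case: Ts Ts' sTs' wu {IH bt gTs gTs' win wl} => [|? ?] [] //= _ _.
  by apply: le_trans wT'T _; rewrite lerD2l.
Qed.

(** The edges of [D] are deleted one by one, at a price of at most [t] each; windows free of all of
    [D] serve for every single deletion. *)
Lemma greedy_delete_seq A M t Ts D L : (forall f, 0 <= c f) -> 0 <= M ->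
  M *+ size Ts <= t -> (forall f, A f -> c f <= t -> f \in L) ->
  greedy_in A Ts -> windows [pred f | A f & f \notin D] 0 M (size Ts) ->
  exists Ts', [/\ size Ts' = size Ts, greedy_in [pred f | A f & f \notin D] Ts',
    w (last [::] Ts) <= w (last [::] Ts') &
    w (last [::] Ts') <= w (last [::] Ts) + t *+ size D].
Proof.
move=> c0 M0; elim: D A Ts => [|e D IH] A Ts Mt AL gTs win.
  exists Ts; split=> //; last by rewrite addr0.
  by apply: eq_greedy_in gTs => f; rewrite /= andbT.
have [||Ts1 [sTs1 gTs1 wl1 wu1]] := @greedy_delete A 0 M t Ts e L c0 (lexx _) M0 _ AL gTs.
- by rewrite add0r.
- apply: windows_sub win => f /=; rewrite inE negb_or.
  by case/and3P => -> ->.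
have E1 : [pred f | A f & f \notin e :: D] =1
    [pred f | [pred f | A f & f != e] f & f \notin D].
  by move=> f; rewrite /= inE negb_or andbA.
have [|||Ts2 [sTs2 gTs2 wl2 wu2]] := IH [pred f | A f & f != e] Ts1 _ _ gTs1.
- by rewrite sTs1.
- by move=> f /andP[Af _]; exact: AL.
- rewrite sTs1; apply: windows_sub win => f; by rewrite E1.
exists Ts2; split.
- by rewrite sTs2.
- by apply: eq_greedy_in gTs2 => f; rewrite E1.
- exact: le_trans wl2.
- apply: le_trans wu2 _; rewrite mulrS addrA lerD2r; exact: wu1.
Qed.

End Greedy.

(** * Greedy trees along an embedding of edge sets *)

Section Embedding.
Context {R : realType} {n : nat} {E1 E2 : eqType} (h : E1 -> E2).
Context (ends1 : E1 -> 'I_n * 'I_n) (ends2 : E2 -> 'I_n * 'I_n).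
Context (c1 : E1 -> R) (c2 : E2 -> R).
Hypotheses (inj_h : injective h) (ends_h : forall e, ends2 (h e) = ends1 e)
  (c_h : forall e, c2 (h e) = c1 e).

Lemma spanning_tree_map F : spanning_tree ends2 (map h F) <-> spanning_tree ends1 F.
Proof.
have adj_h G : adj ends2 (map h G) =2 adj ends1 G.
  by move=> x y; rewrite /adj has_map; apply: eq_has => e /=; rewrite ends_h.
have conn_h G : connect (adj ends2 (map h G)) =2 connect (adj ends1 G).
  exact: eq_connect.
have rem_h e G : rem (h e) (map h G) = map h (rem e G).
  by elim: G => //= g G ->; rewrite (inj_eq inj_h); case: eqP.
split=> -[uF cF bF]; split.
- by rewrite -(map_inj_uniq inj_h).
- by move=> x y; rewrite -conn_h.
- move=> e eF; rewrite -ends_h -conn_h -rem_h; apply: bF; exact: map_f.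
- by rewrite (map_inj_uniq inj_h).
- by move=> x y; rewrite conn_h.
- by move=> _ /mapP[e eF ->]; rewrite ends_h rem_h conn_h; exact: bF.
Qed.

Lemma weight_map F : weight c2 (map h F) = weight c1 F.
Proof. by rewrite /weight big_map; apply: eq_bigr => e _; rewrite c_h. Qed.

(** All available edges lie in the image of [h], so each tree pulls back, while competitors push
    forward with the same weight. *)
Lemma greedy_in_preim (A : pred E2) Ts : (forall e, A e -> exists e', e = h e') ->
  greedy_in ends2 c2 A Ts -> exists2 Ts1, Ts = map (map h) Ts1 &
    greedy_in ends1 c1 (preim h A) Ts1.
Proof.
elim: Ts A => [|T Ts IH] A Ah; first by exists [::].
move=> /= [[tT AT Tmin] gTs].
have [T1 TE] : exists T1, T = map h T1.
  elim: T AT {tT Tmin gTs} => [|e T IHT] /=; first by exists [::].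
  by case/andP => /Ah[e' ->] /IHT[T1 ->]; exists (e' :: T1).
have [|Ts1 TsE gTs1] := IH _ _ gTs; first by move=> e /andP[/Ah].
exists (T1 :: Ts1); first by rewrite TE TsE.
split; last first.
  apply: eq_greedy_in gTs1 => e /=; by rewrite TE (mem_map inj_h).
split; first by apply/spanning_tree_map; rewrite -TE.
  by rewrite TE all_map in AT.
move=> F tF AF; rewrite -!weight_map -TE; apply: Tmin; last by rewrite all_map.
by apply/spanning_tree_map.
Qed.

End Embedding.

(** * Multigraph versus simple graph *)

Section Comparison.
Context {R : realType} {n : nat} (g : epair n -> nat -> R) (k : nat) (M : R).
Hypotheses (g0 : forall p m, 0 <= g p m) (M0 : 0 <= M).
Let cost (q : epair n * nat) : R := \sum_(m < q.2.+1) g q.1 m.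
Let t : R := M *+ k.
Hypothesis at_most_two : forall p, ~~ [&& g p 0%N <= t, g p 1%N <= t & g p 2%N <= t].
Hypothesis connecting : forall j (X : {set 'I_n}) x y,
  (j < k)%N -> x \in X -> y \notin X ->
  exists p : epair n, [/\ crosses val X p, M *+ j < g p 0%N & g p 0%N <= M *+ j.+1].

Let cost0 (q : epair n * nat) : 0 <= cost q.
Proof. exact: sumr_ge0. Qed.

Let arrival_le p m i : cost (p, m) <= t -> (i <= m)%N -> g p i <= t.
Proof.
move=> + im; apply: le_trans.
have im' : (i < m.+1)%N by [].
by rewrite /cost (bigD1 (Ordinal im'))//= lerDl sumr_ge0.
Qed.

(** A third or later parallel edge costs at least as much as each of the first three gaps, one of
    which exceeds [t]. *)
Let cheap_index q : cost q <= t -> (q.2 < 2)%N.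
Proof.
case: q => p [|[|m]]//= qt; case/negP: (at_most_two p).
by rewrite !(arrival_le qt).
Qed.

Let L : seq (epair n * nat) := [seq (p, m) | p <- enum {: epair n}, m <- iota 0 2].

Let cheap_list q : cost q <= t -> q \in L.
Proof.
move=> /cheap_index q2; case: q q2 => p m mk.
by apply: allpairs_f; rewrite ?mem_enum// mem_iota.
Qed.

Let cost_first p : cost (p, 0%N) = g p 0%N.
Proof. by rewrite /cost big_ord1. Qed.

Let windows_first (A : pred (epair n * nat)) :
  (forall p, A (p, 0%N)) -> windows (fun q => val q.1) cost A 0 M k.
Proof.
move=> A0 j X x y jk xX yX; have [p [pX jp pj]] := connecting jk xX yX.
by exists (p, 0%N); rewrite cost_first !add0r; split.
Qed.

Lemma multigraph_greedy_exists :
  exists2 Ts, size Ts = k & greedy_MSTs (fun q : epair n * nat => val q.1) cost Ts.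
Proof.
have [|//|Ts sTs gTs] := @greedy_exists _ _ _ (fun q : epair n * nat => val q.1)
  cost predT 0 M k L M0 _ (windows_first _).
  by move=> q _; rewrite add0r; exact: cheap_list.
by exists Ts => //; apply/greedy_inP.
Qed.

(** All edges except first arrivals are removed in two steps: those of cost above [t] are used by no
    tree, and the cheap ones are second arrivals, whose deletion costs at most [t] each. What
    remains is a copy of the simple graph. *)
Lemma multigraph_simple_weight Ts : size Ts = k ->
  greedy_MSTs (fun q : epair n * nat => val q.1) cost Ts ->
  exists Ts1, [/\ size Ts1 = k,
    greedy_MSTs (fun p : epair n => val p) (g^~ 0%N) Ts1,
    weight cost (last [::] Ts) <= weight (g^~ 0%N) (last [::] Ts1) &
    weight (g^~ 0%N) (last [::] Ts1) <=
      weight cost (last [::] Ts) + t *+ #|[pred p | (g p 0%N <= t) && (g p 1%N <= t)]| ].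
Proof.
move=> sTs /greedy_inP gTs.
(* First arrivals stay at any cost, as they are the edges of the simple graph. *)
pose A0 : pred (epair n * nat) := [pred q | (q.2 == 0%N) || (cost q <= t)].
(* Bounding the two gaps separately may count more pairs than have a second arrival of cost at most
   [t], but it makes independence directly applicable. *)
pose P := [pred p | (g p 0%N <= t) && (g p 1%N <= t)].
pose D := [seq (p, 1%N) | p <- enum P].
have {}gTs : greedy_in (fun q : epair n * nat => val q.1) cost A0 Ts.
  apply: (greedy_in_restrict gTs) => // T q TTs qT _.
  have := greedy_cost_le M0 gTs _ TTs qT; rewrite sTs => /(_ 0 (windows_first _)).
  by rewrite add0r /A0 /= => ->//; rewrite orbT.
have [|||Ts' [sTs' gTs' wl wu]] :=
    @greedy_delete_seq _ _ _ _ _ A0 M t Ts D L cost0 M0 _ _ gTs.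
- by rewrite sTs.
- by move=> q _; exact: cheap_list.
- rewrite sTs; apply: windows_first => p /=.
  by apply/mapP => -[].
have [|||Ts1 Ts1E gTs1] := @greedy_in_preim _ _ _ _ (fun p : epair n => (p, 0%N))
  (fun p => val p) (fun q : epair n * nat => val q.1) (g^~ 0%N) cost _ _ cost_first _ _ _ gTs'.
- by move=> p p' [].
- by [].
- move=> [p m] /= /andP[/orP[/eqP/= ->|pmt] pD]; first by exists p.
  move: (cheap_index pmt) pD => /=; case: m pmt => [|[|]]//= pmt _.
    by exists p.
  case/negP; apply/mapP; exists p => //; rewrite mem_enum inE.
  by rewrite !(arrival_le pmt).
exists Ts1; split.
- by rewrite -sTs -sTs' Ts1E size_map.
- apply/greedy_inP; apply: eq_greedy_in gTs1 => p /=.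
  by apply/negP => /mapP[].
- apply: le_trans wl _; rewrite Ts1E.
  by rewrite (last_map (map _) Ts1 [::]) (weight_map cost_first).
- rewrite -(weight_map cost_first) -(last_map (map _) Ts1 [::]) -Ts1E.
  by apply: le_trans wu _; rewrite size_map -cardE.
Qed.

End Comparison.

(** * Measurability *)

Local Open Scope classical_set_scope.

Section Measurability.
Context {d} {T : measurableType d} {R : realType}.

Lemma measurable_prop (Q : Prop) : measurable [set _ : T | Q].
Proof.
have [q|nq] := pselect Q.
  by rewrite (_ : mkset _ = setT)//; apply/seteqP; split.
by rewrite (_ : mkset _ = set0)//; apply/seteqP; split.
Qed.

Lemma measurable_exists (I : countType) (Q : I -> T -> Prop) :
  (forall i, measurable [set w | Q i w]) -> measurable [set w | exists i, Q i w].
Proof.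
move=> mQ; rewrite (_ : mkset _ = \bigcup_i [set w | Q i w]).
  by apply: countable_bigcupT_measurable => //; exact: countableP.
by apply/seteqP; split=> [w [i Qi]|w [i _ Qi]]; exists i.
Qed.

Lemma measurable_not (Q : T -> Prop) :
  measurable [set w | Q w] -> measurable [set w | ~ Q w].
Proof. exact: measurableC. Qed.

Lemma measurable_forall (I : countType) (Q : I -> T -> Prop) :
  (forall i, measurable [set w | Q i w]) -> measurable [set w | forall i, Q i w].
Proof.
move=> mQ; rewrite (_ : mkset _ = ~` [set w | exists i, ~ Q i w]).
  by apply/measurableC/measurable_exists => i; exact: measurable_not.
apply/seteqP; split=> w /= => [Qw [i]|nQ i]; first exact.
by apply: contra_notP nQ => ?; exists i.
Qed.

Lemma measurable_and (Q1 Q2 : T -> Prop) : measurable [set w | Q1 w] ->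
  measurable [set w | Q2 w] -> measurable [set w | Q1 w /\ Q2 w].
Proof. exact: measurableI. Qed.

Lemma measurable_or (Q1 Q2 : T -> Prop) : measurable [set w | Q1 w] ->
  measurable [set w | Q2 w] -> measurable [set w | Q1 w \/ Q2 w].
Proof. exact: measurableU. Qed.

Lemma measurable_imply (Q1 Q2 : T -> Prop) : measurable [set w | Q1 w] ->
  measurable [set w | Q2 w] -> measurable [set w | Q1 w -> Q2 w].
Proof.
move=> m1 m2; rewrite (_ : mkset _ = [set w | ~ Q1 w \/ Q2 w]).
  by apply: measurable_or => //; exact: measurable_not.
apply/seteqP; split=> w /=; last by move=> [].
by move=> Q12; have [/Q12|] := pselect (Q1 w); [right|left].
Qed.

Section KthWeight.
Context {n : nat} {E : countType} (ends : E -> 'I_n * 'I_n) (c : E -> T -> R).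
Hypothesis mc : forall e, measurable_fun setT (c e).

Lemma measurable_weight F : measurable_fun setT (fun w => weight (c^~ w) F).
Proof. by apply: measurable_sum => e; exact: mc. Qed.

Lemma measurable_weight_le F F' :
  measurable [set w | weight (c^~ w) F <= weight (c^~ w) F'].
Proof.
rewrite -[mkset _]setTI.
by apply: measurable_fun_le => //; exact: measurable_weight.
Qed.

(** Edges form a countable type, hence so do lists of edges, and quantifying over trees is a
    countable operation on events. *)
Lemma measurable_greedy Ts : measurable [set w | greedy_MSTs ends (c^~ w) Ts].
Proof.
apply: measurable_forall => i; apply: measurable_imply; first exact: measurable_prop.
pose A e := ~~ has (fun T : seq E => e \in T) (take i Ts).
rewrite (_ : mkset _ = [set w |
    (spanning_tree ends (nth [::] Ts i) /\ all A (nth [::] Ts i)) /\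
    forall F, spanning_tree ends F -> all A F ->
      weight (c^~ w) (nth [::] Ts i) <= weight (c^~ w) F]).
  apply: measurable_and; first exact: measurable_prop.
  apply: measurable_forall => F; apply: measurable_imply; first exact: measurable_prop.
  apply: measurable_imply; first exact: measurable_prop.
  exact: measurable_weight_le.
by apply/seteqP; split=> w /= [] => [|[]].
Qed.

(** The value [+oo] is never within [eps] of [gamma], so the event splits into a deviating finite
    weight and the absence of [k] greedy trees. *)
Lemma measurable_kth_weight k (gamma eps : R) : measurable
  [set w | exists x, kth_MST_weight ends (c^~ w) k x /\
                     ~ (`|x - gamma%:E| <= eps%:E)%E].
Proof.
rewrite (_ : mkset _ = [set w |
  (exists Ts, (size Ts = k /\ greedy_MSTs ends (c^~ w) Ts) /\
    ~ (`|weight (c^~ w) (last [::] Ts) - gamma| <= eps)) \/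
  ~ exists Ts, size Ts = k /\ greedy_MSTs ends (c^~ w) Ts]).
  have mg Ts : measurable [set w | size Ts = k /\ greedy_MSTs ends (c^~ w) Ts].
    by apply: measurable_and; [exact: measurable_prop | exact: measurable_greedy].
  apply: measurable_or; last exact/measurable_not/measurable_exists.
  apply: measurable_exists => Ts; apply: measurable_and => //.
  apply: measurable_not; rewrite -[mkset _]setTI.
  apply: measurable_fun_le => //; apply: measurableT_comp => //.
  by apply: measurable_funB => //; exact: measurable_weight.
apply/seteqP; split=> w /=.
  move=> [x [[[Ts [sTs gTs ->]]|[-> noTs]] xg]]; last by right.
  by left; exists Ts; split.
move=> [[Ts [[sTs gTs] Tg]]|noTs].
  exists (weight (c^~ w) (last [::] Ts))%:E; split=> //.
  by left; exists Ts.
by exists +oo%E; split; [right|].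
Qed.

End KthWeight.
End Measurability.

(** * Probability bounds *)

Section ExponentialBounds.
Context {R : realType}.

Lemma exponential_prob_lt0 : exponential_prob (1 : R) `]-oo, 0[ = 0%E.
Proof.
apply: integral0_eq => x /=; rewrite in_itv /= => x0.
by rewrite lt0_exponential_pdf.
Qed.

Lemma exponential_prob_itv0_le (t : R) : 0 < t ->
  (exponential_prob (1 : R) `[0%R, t] <= t%:E)%E.
Proof.
move=> t0; rewrite exponential_prob_itv0c// -EFinB lee_fin mulN1r.
by have := expR_ge1Dx (- t); lra.
Qed.

Lemma exponential_prob_itv_ge (a b : R) : 0 <= a -> a < b ->
  ((expR (- b) * (b - a))%:E <= exponential_prob (1 : R) `]a, b])%E.
Proof.
move=> a0 ab; rewrite /exponential_prob.
have -> : (expR (- b) * (b - a))%:E =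
    (\int[lebesgue_measure]_(x in `]a, b]) (expR (- b))%:E)%E.
  by rewrite integral_cst//= lebesgue_measure_itv/= lte_fin ab.
apply: ge0_le_integral => //.
- apply/measurable_EFinP; apply: measurable_funTS; exact: measurable_exponential_pdf.
- move=> x /=; rewrite in_itv/= => /andP[ax xb].
  rewrite exponential_pdfE ?(le_trans a0 (ltW ax))// lee_fin mul1r ler_expR; lra.
Qed.

End ExponentialBounds.

Section Events.
Context {d} {T : measurableType d} {R : realType} (P : probability T R).

Lemma measure_null_exists (I : countType) (A : I -> set T) :
  (forall i, measurable (A i)) -> (forall i, P (A i) = 0%E) ->
  P [set w | exists i, A i w] = 0%E.
Proof.
move=> mA A0; pose B m := if unpickle m is Some i then A i else set0.
have mB m : measurable (B m) by rewrite /B; case: unpickle.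
have -> : [set w | exists i, A i w] = \bigcup_m B m.
  apply/seteqP; split=> [w [i Ai]|w [m _]].
    by exists (pickle i) => //; rewrite /B pickleK.
  by rewrite /B; case: unpickle => // i Ai; exists i.
apply/eqP; rewrite eq_le measure_ge0 andbT.
have mUB : measurable (\bigcup_m B m) by exact: bigcup_measurable.
apply: le_trans (generalized_Boole_inequality _ mB mUB) _.
rewrite eseries0// => m _ _; rewrite /B; case: unpickle => //; exact: measure0.
Qed.

Lemma measure_exists_le (I : finType) (A : I -> set T) (x : I -> R) :
  (forall i, measurable (A i)) -> (forall i, P (A i) <= (x i)%:E)%E ->
  measurable [set w | exists i, A i w] /\
  (P [set w | exists i, A i w] <= (\sum_i x i)%:E)%E.
Proof.
move=> mA Ax; have -> : [set w | exists i, A i w] = \big[setU/set0]_(i <- enum I) A i.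
  rewrite -bigcup_seq; apply/seteqP; split=> [w [i Ai]|w [i _ Ai]]; exists i => //=.
  by rewrite mem_enum.
have mU s : measurable (\big[setU/set0]_(i <- s) A i) by exact: bigsetU_measurable.
split; first exact: mU.
rewrite -[in leRHS]big_enum/=; elim: (enum I) => [|i s IH].
  by rewrite !big_nil measure0.
rewrite !big_cons; apply: le_trans (measureU2 _ (mA i) (mU s)) _.
by rewrite EFinD; apply: leeD (Ax i) IH.
Qed.

(** Markov's inequality for the number of events that occur. *)
Lemma measure_count_ge (I : finType) (A : I -> set T) (x : I -> R) (y : R) :
  0 < y -> (forall i, measurable (A i)) -> (forall i, P (A i) <= (x i)%:E)%E ->
  measurable [set w | y <= \sum_i \1_(A i) w] /\
  (P [set w | (y <= \sum_i \1_(A i) w)%R] <= ((\sum_i x i) / y)%:E)%E.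
Proof.
move=> y0 mA Ax.
have mS : measurable_fun setT (fun w => \sum_i \1_(A i) w : R).
  by apply: measurable_sum => i; exact: measurable_indic.
set B := [set w | _].
have mB : measurable B.
  by rewrite /B -[mkset _]setTI; apply: measurable_fun_le => //; exact: measurable_cst.
split=> //; rewrite EFinM lee_pdivlMr// muleC.
have -> : (y%:E * P B)%E = (\int[P]_w (y%:E * (\1_B w)%:E))%E.
  rewrite ge0_integralZl_EFin ?ltW//; last first.
  - by apply/measurable_EFinP; exact: measurable_indic.
  - by rewrite integral_indic// setIT.
apply: (@le_trans _ _ (\int[P]_w \sum_i (\1_(A i) w)%:E)%E).
  apply: ge0_le_integral => //.
  - by move=> w _; rewrite mule_ge0// lee_fin ltW.
  - apply/measurable_EFinP; apply: measurable_funM => //.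
  - under eq_fun do rewrite sumEFin; exact/measurable_EFinP.
  move=> w _; rewrite sumEFin -EFinM lee_fin indicE.
  have [/set_mem wB|_] := boolP (w \in B); first by rewrite mulr1.
  by rewrite mulr0; apply: sumr_ge0.
rewrite ge0_integral_sum//; last first.
  by move=> i; apply/measurable_EFinP; exact: measurable_indic.
rewrite -sumEFin; apply: lee_sum => i _.
by rewrite integral_indic// setIT; exact: Ax.
Qed.

Lemma prod_prob_le (I : Type) (J : seq I) (A : I -> set T) (q : R) :
  (forall i, P (A i) <= q%:E)%E -> (\prod_(i <- J) P (A i) <= (q ^+ size J)%:E)%E.
Proof.
move=> Aq; elim: J => [|i J IH]; first by rewrite big_nil.
rewrite big_cons /= exprS EFinM; apply: lee_pmul => //.
by elim: (J) => [|? ? ?]; rewrite ?big_nil// big_cons mule_ge0.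
Qed.

Lemma sum_subset_expr (I : finType) (r : R) :
  \sum_(S : {set I}) r ^+ #|S| = (1 + r) ^+ #|I|.
Proof.
have -> : (1 + r) ^+ #|I| = \prod_(i : I) (r + 1) by rewrite prodr_const addrC.
rewrite bigA_distr; apply: eq_bigr => S _.
by rewrite -big_mkcond /= prodr_const.
Qed.

End Events.

(** * The exceptional event *)

Lemma card_epair_le n : (#|{: epair n}| <= n * n)%N.
Proof.
by rewrite card_sig; apply: leq_trans (max_card _) _; rewrite card_prod card_ord.
Qed.

(** Listing the end in [S] first maps the crossing pairs onto the product of [S] and its
    complement. *)
Lemma card_cut n (S : {set 'I_n}) :
  (#|S| * #|~: S| <= #|[pred p : epair n | crosses val S p]|)%N.
Proof.
pose f (p : epair n) : 'I_n * 'I_n :=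
  if (val p).1 \in S then val p else ((val p).2, (val p).1).
rewrite -cardsX; apply: leq_trans (leq_imset_card f _).
apply/subset_leq_card/fintype.subsetP => -[x y]; rewrite finset.in_setX !inE /= => /andP[xS yS].
have xy : x != y by apply: contraNneq yS => <-.
have [lt_xy|lt_yx|/val_inj xyE] := ltngtP x y; last by rewrite xyE eqxx in xy.
  apply/imsetP; exists (exist _ (x, y) lt_xy : epair n); last by rewrite /f /= xS.
  by rewrite inE /crosses /= xS (negbTE yS).
apply/imsetP; exists (exist _ (y, x) lt_yx : epair n); last by rewrite /f /= (negbTE yS).
by rewrite inE /crosses /= xS (negbTE yS).
Qed.

Section BadEvent.
Context {d} {T : measurableType d} {R : realType} (P : probability T R).
Context (n k : nat) (Y : epair n * nat -> {RV P >-> R}) (M delta : R).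
Hypotheses (iidY : iid_exp1 P Y) (k_gt0 : (0 < k)%N) (M_gt0 : 0 < M)
  (delta_gt0 : 0 < delta).
Let t : R := M *+ k.
Hypothesis t_le : t <= 2^-1.

Let t_gt0 : 0 < t. Proof. by rewrite pmulrn_lgt0. Qed.

Lemma measurable_preimage_RV i (A : set R) : measurable A -> measurable (Y i @^-1` A).
Proof. by move=> mA; rewrite -[X in measurable X]setTI; exact: measurable_funPT. Qed.

Lemma all_exp_le (J : seq (epair n * nat)) : uniq J ->
  measurable [set w | forall q, q \in J -> 0 <= Y q w <= t] /\
  (P [set w | forall q, q \in J -> (0 <= Y q w <= t)%R] <= (t ^+ size J)%:E)%E.
Proof.
move=> uJ; have -> : [set w | forall q, q \in J -> 0 <= Y q w <= t] =
    \bigcap_(q in [set` J]) (Y q @^-1` `[0, t]).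
  apply/seteqP; split=> w /= h q /= qJ; first by rewrite in_itv/= h.
  by have := h q qJ; rewrite /= in_itv.
split.
  apply: fin_bigcap_measurable => [|q _]; first exact: finite_seq.
  exact: measurable_preimage_RV.
rewrite iidY.1//; apply: prod_prob_le => q.
by rewrite iidY.2//; exact: exponential_prob_itv0_le.
Qed.

Let q : R := expR (- (M / 2)).

(** As [t <= 1/2], the density is at least [1/2] on the window, which is therefore hit with
    probability at least [M / 2]; and [1 - M / 2 <= expR (- (M / 2))]. *)
Lemma window_avoid_le i j : (j < k)%N ->
  (P (Y i @^-1` (~` `](M *+ j)%R, (M *+ j.+1)%R]%classic)) <= q%:E)%E.
Proof.
move=> jk; set W : set R := [set` _].
have mW : measurable W by exact: measurable_itv.
have -> : P (Y i @^-1` (~` W)) = (1 - exponential_prob 1 W)%E.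
  rewrite -(iidY.2 i) // -probability_setC//; exact: measurable_preimage_RV.
have M0 := ltW M_gt0.
have ab : M *+ j < M *+ j.+1 by rewrite mulrSr ltrDl.
have := exponential_prob_itv_ge (mulrn_wge0 j M0) ab.
have bt : M *+ j.+1 <= t by rewrite /t ler_pMn2l.
rewrite -/W; set p := exponential_prob _ _ => pge.
have e1 := expR_ge1Dx (- (M *+ j.+1)).
have e2 : 1 - M / 2 <= q := expR_ge1Dx _.
apply: (@le_trans _ _ (1 - (M / 2)%:E)%E); last by rewrite -EFinB lee_fin.
apply: leeB => //; apply: le_trans pge; rewrite lee_fin.
have -> : M *+ j.+1 - M *+ j = M by rewrite mulrSr addrAC subrr add0r.
rewrite mulrC ler_wpM2r//; move: t_le; lra.
Qed.

Definition cut_avoids (j : nat) (S : {set 'I_n}) : set T :=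
  [set w | forall p : epair n, crosses val S p ->
             ~~ (M *+ j < Y (p, 0%N) w <= M *+ j.+1)].

Lemma cut_avoids_le j S : (j < k)%N ->
  measurable (cut_avoids j S) /\
  (P (cut_avoids j S) <= (q ^+ (#|S| * #|~: S|))%:E)%E.
Proof.
move=> jk; pose J := [seq (p, 0%N) | p : epair n in [pred p | crosses val S p]].
have -> : cut_avoids j S = \bigcap_(i in [set` J]) (Y i @^-1` (~` `]M *+ j, M *+ j.+1])).
  apply/seteqP; split=> w /= h.
    by move=> _ /= /fintype.imageP[p pS ->] /=; rewrite in_itv /=; apply/negP; exact: h.
  move=> p pS; have pJ : (p, 0%N) \in J by apply/fintype.imageP; exists p.
  by have := h _ pJ; rewrite /= in_itv /= => /negP.
split.
  apply: fin_bigcap_measurable => [|i _]; first exact: finite_seq.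
  apply: measurable_preimage_RV.
  exact: measurableC.
rewrite iidY.1; last 2 first.
- by rewrite map_inj_uniq ?enum_uniq// => p p' [].
- by move=> _; exact: measurableC.
have := prod_prob_le J (fun i => window_avoid_le i jk); move=> /le_trans; apply.
rewrite lee_fin size_image; apply: ler_wiXn2l (card_cut S).
  exact: expR_ge0.
by rewrite -expR0 ler_expR; move: M_gt0; lra.
Qed.

(** If [S] is the smaller side of a cut, its complement has at least [n./2] vertices, so a given
    window misses the cut with probability at most [r ^+ #|S|]. *)
Let r : R := q ^+ n./2.

(** Union bound over the [k] windows and the nonempty [S] no larger than their complement; extending
    the sum of [r ^+ #|S|] to all nonempty sets gives [(1 + r) ^+ n - 1]. *)
Lemma disconnected_le : exists A : set T, [/\ measurable A,
  (P A <= (k%:R * ((1 + r) ^+ n - 1))%:E)%E &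
  forall w, ~ A w -> forall j (X : {set 'I_n}) x y, (j < k)%N -> x \in X -> y \notin X ->
    exists p : epair n,
      [/\ crosses val X p, M *+ j < Y (p, 0%N) w & Y (p, 0%N) w <= M *+ j.+1]].
Proof.
pose good (S : {set 'I_n}) := (S != finset.set0) && (#|S| <= #|~: S|)%N.
pose B (i : 'I_k * {set 'I_n}) := if good i.2 then cut_avoids i.1 i.2 else set0.
pose x (i : 'I_k * {set 'I_n}) : R := if i.2 != finset.set0 then r ^+ #|i.2| else 0.
have r0 : 0 <= r by rewrite exprn_ge0// expR_ge0.
have q1 : q <= 1 by rewrite -expR0 ler_expR; move: M_gt0; lra.
have [||mB PB] := @measure_exists_le _ _ _ P _ B x.
- by move=> [j S]; rewrite /B; case: ifP => // _; case: (cut_avoids_le S (ltn_ord j)).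
- move=> [j S]; rewrite /B /x /good /=; case: eqVneq => [_|S0] /=; first by rewrite measure0.
  case: leqP => [SS|_]; last by rewrite measure0 lee_fin exprn_ge0.
  case: (cut_avoids_le S (ltn_ord j)) => _ /le_trans; apply.
  rewrite lee_fin /r -exprM ler_wiXn2l ?expR_ge0// mulnC leq_mul2l; apply/orP; right.
  rewrite leq_half_double; apply: leqW.
  by rewrite -[X in (X <= _)%N](card_ord n) -(cardsC S) -addnn leq_add2r.
exists [set w | exists i, B i w]; split=> //.
  apply: le_trans PB _; rewrite lee_fin -(pair_bigA _ (fun j S => x (j, S))) /x /=.
  rewrite sumr_const card_ord mulr_natl lerMn2r; apply/orP; right.
  rewrite -[X in (1 + r) ^+ X](card_ord n) -sum_subset_expr (bigD1 finset.set0)//= [in leRHS](bigD1 finset.set0)//=.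
  rewrite eqxx cards0 expr0 add0r addrAC subrr add0r.
  by apply: ler_sum => S S0; rewrite S0.
move=> w nB j X x0 y0 jk xX yX; apply: contrapT => nop; apply: nB.
have avoid S : (forall e : epair n, crosses val S e = crosses val X e) -> cut_avoids j S w.
  move=> SX p; rewrite SX => pX; apply/negP => /andP[? ?].
  by apply: nop; exists p.
(* The smaller of [X] and its complement indexes the failure; both have the same crossing pairs. *)
have [le|/ltnW le] := leqP #|X| #|~: X|.
  exists (Ordinal jk, X); rewrite /B /good /= le andbT.
  by rewrite ifT; [exact: avoid | apply/set0Pn; exists x0].
exists (Ordinal jk, ~: X); rewrite /B /good /= finset.setCK le andbT.
rewrite ifT; last by apply/set0Pn; exists y0; rewrite inE.
by apply: avoid => e; rewrite crosses_setC.
Qed.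

(** Four exceptional sets: [A2], a negative value, is null; [A1] is a failing window; [A3], a pair
    with three short gaps, is handled by a union bound over at most [n ^+ 2] pairs; [A4], at least
    [delta / t] pairs with two short gaps, by Markov's inequality. *)
Lemma bad_event : exists A : set T, [/\ measurable A,
  (P A <= (k%:R * ((1 + r) ^+ n - 1) + n%:R ^+ 2 * t ^+ 3 +
           n%:R ^+ 2 * t ^+ 3 / delta)%:E)%E &
  forall w, ~ A w -> [/\ (forall i, 0 <= Y i w),
    (forall p, ~~ [&& Y (p, 0%N) w <= t, Y (p, 1%N) w <= t & Y (p, 2%N) w <= t]),
    (forall j (X : {set 'I_n}) x y, (j < k)%N -> x \in X -> y \notin X ->
      exists p : epair n,
        [/\ crosses val X p, M *+ j < Y (p, 0%N) w & Y (p, 0%N) w <= M *+ j.+1]) &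
    t *+ #|[pred p | (Y (p, 0%N) w <= t) && (Y (p, 1%N) w <= t)]| <= delta]].
Proof.
have [A1 [mA1 PA1 A1P]] := disconnected_le.
pose A2 := [set w | exists i, (Y i @^-1` `]-oo, 0[) w].
have mneg i : measurable (Y i @^-1` `]-oo, 0[) by exact: measurable_preimage_RV.
have mA2 : measurable A2 by exact: measurable_exists.
have PA2 : P A2 = 0%E.
  apply: measure_null_exists => // i.
  by rewrite iidY.2//; exact: exponential_prob_lt0.
have card_n2 (x : R) : 0 <= x -> \sum_(p : epair n) x <= n%:R ^+ 2 * x.
  move=> x0; rewrite sumr_const -[x *+ _]mulr_natl ler_wpM2r// -natrX ler_nat -mulnn.
  exact: card_epair_le.
pose J3 (p : epair n) := [:: (p, 0%N); (p, 1%N); (p, 2%N)].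
pose J2 (p : epair n) := [:: (p, 0%N); (p, 1%N)].
pose B (J : seq (epair n * nat)) := [set w | forall i, i \in J -> 0 <= Y i w <= t].
have u3 p : uniq (J3 p) by rewrite /= !inE !xpair_eqE !eqxx.
have u2 p : uniq (J2 p) by rewrite /= !inE !xpair_eqE !eqxx.
have [||mA3 PA3] := @measure_exists_le _ _ _ P _ (fun p => B (J3 p)) (fun=> t ^+ 3).
- by move=> p; case: (all_exp_le (u3 p)).
- by move=> p; case: (all_exp_le (u3 p)).
set A3 := [set w | _] in mA3 PA3.
have [|||mA4 PA4] := @measure_count_ge _ _ _ P _ (fun p => B (J2 p)) (fun=> t ^+ 2) (delta / t).
- by rewrite divr_gt0.
- by move=> p; case: (all_exp_le (u2 p)).
- by move=> p; case: (all_exp_le (u2 p)).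
set A4 := [set w | _] in mA4 PA4.
exists (A2 `|` A1 `|` A3 `|` A4); split.
- by do 3?[apply: measurableU => //].
- rewrite !EFinD; apply: le_trans (measureU2 _ _ mA4) _; first by do 2?[apply: measurableU => //].
  apply: leeD; last first.
    apply: le_trans PA4 _; rewrite lee_fin invf_div mulrA ler_wpM2r ?invr_ge0 ?(ltW delta_gt0)//.
    by rewrite [t ^+ 3]exprSr mulrA ler_wpM2r ?(ltW t_gt0)// card_n2// exprn_ge0// ltW.
  apply: le_trans (measureU2 _ (measurableU _ _ mA2 mA1) mA3) _; apply: leeD; last first.
    by apply: le_trans PA3 _; rewrite lee_fin card_n2// exprn_ge0// ltW.
  apply: (@le_trans _ _ (P A2 + P A1)%E); first exact: measureU2.
  by rewrite PA2 add0e.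
move=> w /not_orP[/not_orP[/not_orP[nA2 nA1] nA3] nA4].
have Y0 i : 0 <= Y i w.
  by rewrite leNgt; apply/negP => Yi; apply: nA2; exists i; rewrite /= in_itv.
split=> //.
- move=> p; apply/negP => /and3P[p0 p1 p2]; apply: nA3; exists p => i.
  by rewrite !inE => /or3P[] /eqP ->; rewrite Y0.
- exact: A1P.
have {nA4} : \sum_p \1_(B (J2 p)) w < delta / t by rewrite ltNge; exact/negP.
rewrite ltr_pdivlMr// => /ltW; apply: le_trans.
rewrite -mulr_natl ler_wpM2r ?(ltW t_gt0)// -sum1_card natr_sum big_mkcond /=.
apply: ler_sum => p _; rewrite indicE; case: ifP => // /andP[p0 p1].
by rewrite mem_set// => i; rewrite !inE => /orP[] /eqP ->; rewrite Y0.
Qed.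

End BadEvent.

(** * Asymptotics *)

Lemma iid_exp1_inj d (T : measurableType d) (R : realType) (P : probability T R)
    (I1 I2 : eqType) (h : I1 -> I2) (Y : I2 -> {RV P >-> R}) (h' : I2 -> I1) :
  cancel h h' -> iid_exp1 P Y -> iid_exp1 P (Y \o h).
Proof.
move=> hK [indY expY]; split=> [J B uJ mB|i A mA]; last exact: expY.
have := indY (map h J) (B \o h').
rewrite map_inj_uniq ?uJ; last exact: can_inj hK.
move=> /(_ isT (fun i => mB _)); rewrite big_map.
have -> : \bigcap_(i in [set` map h J]) (Y i @^-1` (B \o h') i) =
    \bigcap_(i in [set` J]) ((Y \o h) i @^-1` B i).
  apply/seteqP; split=> w /= Jw i /=.
    by move=> iJ; have := Jw (h i) (map_f h iJ); rewrite /= hK.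
  by move=> /mapP[i' iJ ->] /=; rewrite hK; exact: Jw.
by move=> ->; apply: eq_bigr => i _ /=; rewrite hK.
Qed.

(** * Choice of the window length *)

Section Rate.
Context {R : realType}.

(** This is [n] to the power [-1/4]. The window length will be its cube, and [n * u ^ 4 = 1] removes
    [n] from the estimates. *)
Definition window_rate (n : nat) : R := Num.sqrt (Num.sqrt n%:R^-1).
Local Notation u := window_rate.

Lemma window_rate_gt0 n : (0 < n)%N -> 0 < u n.
Proof. by move=> n0; rewrite !sqrtr_gt0 invr_gt0 ltr0n. Qed.

Lemma window_rateX4 n : (0 < n)%N -> n%:R * u n ^+ 4 = 1.
Proof.
move=> n0; rewrite /u -[4%N]/(2 * 2)%N exprM !sqr_sqrtr ?sqrtr_ge0 ?invr_ge0//.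
by rewrite divff// pnatr_eq0 -lt0n.
Qed.

Lemma window_rate_cvg0 : u n @[n --> \oo] --> 0.
Proof.
rewrite -cvg_shiftS /=.
suff : u n.+1 @[n --> \oo] --> Num.sqrt (Num.sqrt (0 : R)) by rewrite !sqrtr0.
apply: continuous_cvg; first exact: sqrt_continuous.
apply: continuous_cvg; first exact: sqrt_continuous.
exact: cvg_harmonic.
Qed.

(** Bounds the exceptional probability through [x = window_rate n] alone; continuous, and zero at
    [x = 0]. *)
Definition bad_bound (k : nat) (delta x : R) : R :=
  k%:R * (expR (48 ^+ 6 * x ^+ 2) - 1) + k%:R ^+ 3 * x + k%:R ^+ 3 * x / delta.

Lemma bad_bound_cvg0 k delta : bad_bound k delta (u n) @[n --> \oo] --> 0.
Proof.
have b0 : bad_bound k delta 0 = 0.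
  by rewrite /bad_bound expr0n /= !mulr0 expR0 subrr mulr0 mul0r !addr0.
suff : bad_bound k delta (u n) @[n --> \oo] --> bad_bound k delta 0 by rewrite b0.
apply: (continuous_cvg _ (h := bad_bound k delta)) window_rate_cvg0.
apply: cvgD; [apply: cvgD|].
- apply: cvgM; first exact: cvg_cst.
  apply: cvgB; last exact: cvg_cst.
  apply: continuous_cvg; first exact: continuous_expR.
  by apply: cvgM; [exact: cvg_cst | exact: exprn_continuous].
- by apply: cvgM; [exact: cvg_cst | exact: cvg_id].
- apply: cvgM; last exact: cvg_cst.
  by apply: cvgM; [exact: cvg_cst | exact: cvg_id].
Qed.

(** By [n * x ^ 4 = 1] the terms with [n ^ 2] become multiples of [k ^ 3 * x]. For the connectivity
    term, [(1 + r) ^ n <= expR (n * r)] and [n * r] is of order [x ^ 2]. *)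
Lemma bad_prob_le k n delta : (1 < n)%N -> 0 < delta ->
  k%:R * ((1 + expR (- (u n ^+ 3 / 2)) ^+ n./2) ^+ n - 1) +
  n%:R ^+ 2 * (u n ^+ 3 *+ k) ^+ 3 + n%:R ^+ 2 * (u n ^+ 3 *+ k) ^+ 3 / delta
  <= bad_bound k delta (u n).
Proof.
move=> n1 d0; have n0 : (0 < n)%N by exact: ltn_trans n1.
have u0 := window_rate_gt0 n0; have u4 := window_rateX4 n0.
set x := u n in u0 u4 *; set r := expR _ ^+ _.
have -> : n%:R ^+ 2 * (x ^+ 3 *+ k) ^+ 3 = k%:R ^+ 3 * x.
  rewrite -mulr_natl; transitivity (k%:R ^+ 3 * x * (n%:R * x ^+ 4) ^+ 2); last first.
    by rewrite u4 expr1n mulr1.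
  ring.
rewrite /bad_bound !lerD2r ler_wpM2l// lerD2r.
have r0 : 0 <= r by rewrite exprn_ge0// expR_ge0.
have nr : n%:R * r <= 48 ^+ 6 * x ^+ 2.
  (* This needs [n > 1], since [n./2] vanishes at one. *)
  have half_ge : n%:R / 4 <= n./2%:R :> R.
    rewrite ler_pdivrMr// -natrM ler_nat.
    by rewrite -[X in (X <= _)%N]odd_double_half -muln2; case: odd; case: n n1 {n0 u4 x u0 r r0} => [|[|[|[|n]]]] //= _; lia.
  have r_le : r <= expR (- (8 * x)^-1).
    rewrite /r -expRM_natl ler_expR mulrN lerN2.
    have -> : (8 * x)^-1 = n%:R / 4 * (x ^+ 3 / 2).
      transitivity ((n%:R * x ^+ 4) / (8 * x)); first by rewrite u4 mul1r.
      by field; rewrite lt0r_neq0.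
    by rewrite ler_wpM2r// divr_ge0// exprn_ge0// ltW.
  (* The sixth power leaves [n * x ^ 6 = x ^ 2], which still vanishes. The constant comes from
     [1 / (8 * x) = 6 / (48 * x)] and [expR y >= y] at [y = 1 / (48 * x)]. *)
  have e_le : expR (- (8 * x)^-1) <= (48 * x) ^+ 6.
    rewrite expRN -[leRHS]invrK lef_pV2 ?posrE ?invr_gt0 ?exprn_gt0 ?mulr_gt0 ?expR_gt0//.
    have -> : (8 * x)^-1 = 6%:R * (48 * x)^-1.
      by field; rewrite lt0r_neq0.
    rewrite expRM_natl -exprVn lerXn2r ?nnegrE ?expR_ge0 ?invr_ge0 ?mulr_ge0 ?ltW//.
    by have := expR_ge1Dx ((48 * x)^-1); lra.
  apply: (@le_trans _ _ (n%:R * (48 * x) ^+ 6)).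
    by rewrite ler_wpM2l// (le_trans r_le).
  rewrite le_eqVlt; apply/orP; left; apply/eqP.
  transitivity (48 ^+ 6 * x ^+ 2 * (n%:R * x ^+ 4)); first ring.
  by rewrite u4 mulr1.
apply: (@le_trans _ _ (expR (n%:R * r))); last by rewrite ler_expR.
rewrite expRM_natl lerXn2r ?nnegrE ?expR_ge0 ?addr_ge0//.
exact: expR_ge1Dx.
Qed.

End Rate.

(** * Convergence in the Poisson multigraph *)

Theorem theorem1p2 (R : realType) (k : nat) (gamma : R) :
  (0 < k)%N ->
  (* gamma is the limit in probability of w(T_k) in K_n with i.i.d. Exp(1) costs *)
  (forall d (Omega : measurableType d) (P : probability Omega R)
          (X : forall n, epair n -> {RV P >-> R}),
      (forall n, iid_exp1 P (X n)) ->
      cvg_in_prob P (simple_kth_weight X k) gamma) ->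
  (* then the same holds in the Poisson multigraph model *)
  forall d (Omega : measurableType d) (P : probability Omega R)
         (G : forall n, epair n -> nat -> {RV P >-> R}),
    (forall n, iid_exp1 P (fun q : epair n * nat => G n q.1 q.2)) ->
    cvg_in_prob P (poisson_kth_weight G k) gamma.
Proof.
move=> k0 simple d Omega P G iidG eps eps0.
(* First arrivals give a simple model on the same probability space, so the two weights can be
   compared pointwise. *)
pose X n (p : epair n) : {RV P >-> R} := G n p 0%N.
have iidX n : iid_exp1 P (X n).
  exact: (iid_exp1_inj (h := fun p : epair n => (p, 0%N)) (h' := fst) _ (iidG n)).
(* Half of [eps] goes to the simple model, half to the difference of the two weights. *)
have delta0 : 0 < eps / 2 by rewrite divr_gt0.
have simple0 := simple _ _ P X iidX _ delta0.
set S := (fun n => P _) in simple0.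
have mX n (p : epair n) : measurable_fun setT (X n p) by exact: measurable_funPT.
have mG n (q : epair n * nat) : measurable_fun setT (fun w => \sum_(m < q.2.+1) G n q.1 m w).
  by apply: measurable_sum => m; exact: measurable_funPT.
apply: (squeeze_cvge (f := cst 0%E)
    (h := fun n => (S n + (bad_bound k (eps / 2) (window_rate n))%:E)%E)); last 2 first.
- exact: cvg_cst.
- rewrite -[0%E]adde0; apply: cvgeD => //.
  apply: cvg_EFin; last exact: bad_bound_cvg0.
  by apply: nearW.
have small : \forall n \near \oo, window_rate n ^+ 3 *+ k <= 2^-1 :> R.
  have : (window_rate n : R) ^+ 3 *+ k @[n --> \oo] --> (0 : R) ^+ 3 *+ k.
    apply: (continuous_cvg _ (h := fun x : R => x ^+ 3 *+ k)) (@window_rate_cvg0 R).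
    by apply: cvgMn; exact: exprn_continuous.
  by rewrite expr0n mul0rn => /cvgr_le; apply.
near=> n.
have n1 : (1 < n)%N by near: n; exact: nbhs_infty_gt.
have n0 : (0 < n)%N by exact: ltn_trans n1.
have t_le : window_rate n ^+ 3 *+ k <= 2^-1 :> R by near: n; exact: small.
set M : R := window_rate n ^+ 3 in t_le.
have M0 : 0 < M by rewrite exprn_gt0// window_rate_gt0.
have [A [mA PA AP]] := bad_event (iidG n) k0 M0 delta0 t_le.
rewrite measure_ge0 /=.
set W := [set w | _].
have mW : measurable W by apply: measurable_kth_weight; exact: mG.
set V := [set w | exists x, simple_kth_weight X k n w x /\
  ~ (`|x - gamma%:E| <= (eps / 2)%:E)%E].
have mV : measurable V by apply: measurable_kth_weight; exact: mX.
(* Outside [A], a deviation above [eps] in the multigraph forces one above [eps / 2] in the simple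
   graph. *)
have WVA : W `<=` V `|` A.
  move=> w [x [Wx xg]].
  have [Aw|nAw] := pselect (A w); [by right|left].
  have [g0 two win cnt] := AP w nAw.
  have g0' p m : 0 <= G n p m w by exact: (g0 (p, m)).
  case: Wx => [[Ts [sTs gTs xE]]|[_ noTs]]; last first.
    (* Outside [A] the greedy trees exist, so the value [+oo] does not occur. *)
    have [Ts sTs gTs] := multigraph_greedy_exists (g := fun p m => G n p m w) g0' (ltW M0) two win.
    by case: noTs; exists Ts.
  have [Ts1 [sTs1 gTs1 wl wu]] := multigraph_simple_weight
    (g := fun p m => G n p m w) g0' (ltW M0) two win sTs gTs.
  exists (weight (fun p => X n p w) (last [::] Ts1))%:E; split.
    by left; exists Ts1.
  move: xg; rewrite xE -!EFinB !abse_EFin !lee_fin => xg; apply: contra_not xg.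
  move: wl wu cnt; rewrite /X /=.
  set a := weight _ _; set b := weight _ _; set N := _ *+ #|_| => ab bN Nd.
  rewrite !ler_norml => /andP[h1 h2]; apply/andP; split; lra.
apply: (@le_trans _ _ (P (V `|` A))).
  by apply: le_measure => //; rewrite inE //; exact: measurableU.
apply: le_trans (measureU2 _ mV mA) _; apply: leeD => //.
apply: le_trans PA _; rewrite lee_fin; exact: bad_prob_le.
Unshelve. all: by end_near. Qed.
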